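(* For each $w\in W$, the collections $$P_{w,u_i,a+bt+1}=(w+P_{g^au_i,\omega^b})\ \cup\ \{\,(w-p_i(w)u_i)+Au_i\ :\ A\in Q_{p_i(w),\,a+bt+1}\,\}$$ for $1\leq i\leq N$, $0\leq a<t$, $b\in\{0,1,2\}$, together with $$P_{w,*}=\bigcup_{i=1}^{N}\{\,(w-p_i(w)u_i)+Au_i\ :\ A\in Q_{p_i(w),0}\,\},$$ are parallel classes of $X=W\cup\{\infty_1,\infty_2\}$, and the union $\mathcal{B}_w$ of their triples is a Steiner triple system on $X$; hence $\mathcal{B}_w$ with these classes is a KTS$(q^n+2)$.
   Context: Let $q=6t+1$ be a prime power, $n\geq2$, $W=\mathbb{F}_q^n$, and $X=W\cup\{\infty_1,\infty_2\}$ with $\infty_1,\infty_2\notin W$. A KTS$(v)$ is a Steiner triple system (every pair of points in exactly one block) whose blocks are partitioned into parallel classes (partitions of the point set); an LKTS$(v)$ is a set of $v-2$ pairwise block-disjoint KTS$(v)$ on a common $v$-set. Let $Y=\mathbb{F}_q\cup\{\infty_1,\infty_2\}$ and let $\{\mathcal{D}_i\}_{i\in\mathbb{F}_q}$ be an LKTS$(q+2)$ on $Y$, indexed so that $\{\infty_1,\infty_2,i\}$ is a block of $\mathcal{D}_i$; let $Q_{i,0},\dots,Q_{i,(q-1)/2}$ be the parallel classes of the resolution of $\mathcal{D}_i$, with $\{\infty_1,\infty_2,i\}\in Q_{i,0}$. For $A\subseteq Y$ and $x\in W$ let $Ax=\{ax:a\in A\}$ with $\infty_jx=\infty_j$; for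 $z\in W$ and $S\subseteq X$, $z+S=\{z+s:s\in S\}$ with $z+\infty_j=\infty_j$. For each 2-dimensional subspace $L$ of $W$ fix a nonzero skew-symmetric bilinear form $f_L:L\times L\to\mathbb{F}_q$. Let $g$ generate $\mathbb{F}_q^*$, $\omega=g^{2t}$, $T(u,v)=\{u+v,\omega u+\omega^2v,\omega^2u+\omega v\}$ for linearly independent $u,v$, and $-S=\{-x:x\in S\}$. For a 1-dimensional subspace $K$, nonzero $u\in K$, $c\in\mathbb{F}_q^*$: $P_{u,L,c}=\{\pm T(u,v): v\in L,\ f_L(u,v)=g^mc\text{ for some }0\leq m<t\}$ for 2-dimensional $L\supset K$, and $P_{u,c}=\bigcup_{L\supset K}P_{u,L,c}$ (a set of triples). Let $K_1,\dots,K_N$, $N=(q^n-1)/(q-1)$, be the 1-dimensional subspaces of $W$, $u_i\in K_i$ nonzero, $R_i$ a system of representatives of the cosets of $K_i$ in $W$, and $p_i:W\to\mathbb{F}_q$ the function with $x-p_i(x)u_i\in R_i$ for all $x\in W$. *)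

(* Defs.v *)
From HB Require Import structures.
From mathcomp Require Import all_boot all_order all_fingroup all_algebra.
From mathcomp Require Import all_solvable sesquilinear.

Set Implicit Arguments.
Unset Strict Implicit.
Unset Printing Implicit Defensive.

Import GRing.Theory.
Local Open Scope ring_scope.

Section FiniteVspace.
Import VectorInternalTheory.

(* The subspaces of a space over a finite field form a finite type; the
   library only provides the choice structure. *)
HB.instance Definition _ (F : finFieldType) (vT : vectType F) :=
  [Countable of {vspace vT} by <:].
HB.instance Definition _ (F : finFieldType) (vT : vectType F) :=
  [Finite of {vspace vT} by <:].
End FiniteVspace.

Section Designs.
Variable X : finType.

Definition is_parallel_class (P : {set {set X}}) : Prop :=
  partition P [set: X] /\ (forall B, B \in P -> #|B| = 3%N).

Definition is_STS (Bs : {set {set X}}) : Prop :=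
  (forall B, B \in Bs -> #|B| = 3%N) /\
  (forall x y : X, x != y ->
     exists! B : {set X}, [/\ B \in Bs, x \in B & y \in B]).

(* Res is the resolution, as a set of parallel classes. *)
Definition is_KTS (v : nat) (Bs : {set {set X}}) (Res : {set {set {set X}}}) :
    Prop :=
  [/\ #|X| = v,
      is_STS Bs,
      (forall P, P \in Res -> is_parallel_class P) &
      partition Res Bs].

Definition is_LKTS (v : nat) (S : {set {set {set X}}}) : Prop :=
  [/\ #|X| = v,
      #|S| = (v - 2)%N,
      (forall Bs, Bs \in S -> exists Res, is_KTS v Bs Res) &
      trivIset S].
End Designs.

(* T with two extra points: infinity_1 and infinity_2 are [inr ord0] and
   [inr ord_max]. *)
Notation with_infty T := (T + 'I_2)%type.

Definition infty1 {T : Type} : with_infty T := inr ord0.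
Definition infty2 {T : Type} : with_infty T := inr ord_max.

(* Extension of a map fixing both points at infinity. *)
Definition infty_map (S T : Type) (h : S -> T) (y : with_infty S) :
    with_infty T :=
  match y with inl a => inl (h a) | inr j => inr j end.

Section Construction.
Variables (F : finFieldType) (n : nat).
Local Notation W := 'rV[F]_n.
Local Notation X := (with_infty W).
Local Notation Y := (with_infty F).

Definition coset_representatives (V : {vspace W}) (R : {set W}) : Prop :=
  forall x : W, exists! r : W, r \in R /\ x - r \in V.

Definition scale_set (A : {set Y}) (x : W) : {set X} :=
  infty_map (fun a : F => a *: x) @: A.

Definition shift_set (z : W) (S : {set X}) : {set X} :=
  infty_map (fun s : W => z + s) @: S.

Definition opp_set (S : {set X}) : {set X} :=
  infty_map (fun s : W => - s) @: S.

Definition triple (omega : F) (u v : W) : {set X} :=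
  [set inl (u + v); inl (omega *: u + omega ^+ 2 *: v);
       inl (omega ^+ 2 *: u + omega *: v)].

Variable t : nat.
Variable g : F.
Variable f : forall L : {vspace W}, {skew_symmetric (subvs_of L)}.

Definition omega : F := g ^+ (2 * t).

(* [vsproj L] restricts to the identity on L; it only serves to view u and v
   as elements of L. *)
Definition P_plane (u : W) (L : {vspace W}) (c : F) : {set {set X}} :=
  let V := [set v : W | (v \in L) &&
             [exists m : 'I_t, f L (vsproj L u) (vsproj L v) == g ^+ m * c]] in
  [set triple omega u v | v in V] :|: [set opp_set (triple omega u v) | v in V].

Definition P_vec (u : W) (c : F) : {set {set X}} :=
  \bigcup_(L : {vspace W} | (<[u]> <= L)%VS && (\dim L == 2%N)) P_plane u L c.

Variable Q : F -> nat -> {set {set Y}}.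

(* k is the index of the parallel class, u spans the direction, and p is its
   coordinate function. *)
Definition line_blocks (w u : W) (p : W -> F) (k : nat) : {set {set X}} :=
  [set shift_set (w - p w *: u) (scale_set A u) | A : {set Y} in Q (p w) k].

Definition P_class (w u : W) (p : W -> F) (a b : nat) : {set {set X}} :=
  [set shift_set w S | S : {set X} in P_vec (g ^+ a *: u) (omega ^+ b)]
  :|: line_blocks w u p (a + b * t + 1).

Variables (N : nat) (u : 'I_N -> W) (p : 'I_N -> W -> F).

Definition P_star (w : W) : {set {set X}} :=
  \bigcup_(i < N) line_blocks w (u i) (p i) 0.

Definition classes_at (w : W) : {set {set {set X}}} :=
  P_star w |:
    [set P_class w (u iab.1.1) (p iab.1.1) iab.1.2 iab.2
       | iab : 'I_N * 'I_t * 'I_3].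

Definition blocks_at (w : W) : {set {set X}} := cover (classes_at w).

End Construction.

(* Main.v *)
Require Import Defs.
From HB Require Import structures.
From mathcomp Require Import all_boot all_order all_fingroup all_algebra.
From mathcomp Require Import all_solvable sesquilinear.
From mathcomp Require Import finfield ring zify.

Set Implicit Arguments.
Unset Strict Implicit.
Unset Printing Implicit Defensive.

Import GRing.Theory.
Local Open Scope ring_scope.

(** Every nonzero scalar is uniquely [(-1)^e omega^j g^m] with [e < 2], [j < 3],
    [m < t].  Writing [phi] for the form of the plane spanned by its arguments,
    a point [x] off the line of [u] lies on [+-T(u,v)] exactly when
    [v = -omega^j u +- omega^(2j) x], and then [phi(u,v) = +- omega^(2j) phi(u,x)];
    so one sign and one [j] put [phi(u,v)] in [{g^m c}], and the blocks of
    [P_{u,c}] partition [W \ K].  The line blocks of the same class are an affine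
    copy of a parallel class of [D_{p(w)}], covering [w + K] and the two points at
    infinity.

    Relative to [w], two dependent points lie on a common line and are joined
    inside a copy of some [D_i]; all these copies share the block
    [{infty1, infty2, w}] and nothing else.  Two independent points [x, y] can only
    be joined by [{x, y, -x-y}].  This triple is [T(u,v)] for [(u,v)] unique up to
    swapping and to [(+-omega^j u, +-omega^(2j) v)].  The second freedom preserves
    [phi(u,v)] and normalises [u] to some [g^a u_i]; the swap negates [phi(u,v)],
    so exactly one order makes it [omega^b g^m].  Hence the triple occurs for
    exactly one [(i,a,b)], which also makes the classes disjoint. *)

(** * Scalars *)

Section HalfSystem.
Variables (F : finFieldType) (t : nat) (g : {unit F}).
Hypothesis card_F : #|F| = (6 * t + 1)%N.
Hypothesis gen_g : generator [set: {unit F}] g.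
Local Notation w := (omega t (val g)).

Lemma order_primitive : #[g]%g = (6 * t)%N.
Proof.
have /eqP := gen_g; rewrite /order => <-.
by rewrite card_finField_unit card_F addn1.
Qed.

Lemma t_gt0 : (0 < t)%N.
Proof. by have := order_gt0 g; rewrite order_primitive muln_gt0. Qed.

Lemma expr_primitive_eq1 k : (val g ^+ k == 1) = (6 * t %| k)%N.
Proof.
by rewrite -order_primitive order_dvdn -FinRing.val_unitX -val_eqE.
Qed.

Lemma omega_cube : w ^+ 3 = 1.
Proof.
by apply/eqP; rewrite /omega -exprM expr_primitive_eq1 mulnAC dvdnn.
Qed.

Lemma omega_neq1 : w != 1.
Proof.
rewrite /omega expr_primitive_eq1 gtnNdvd ?muln_gt0 ?t_gt0 //.
by rewrite ltn_pmul2r ?t_gt0.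
Qed.

Lemma omega_neq0 : w != 0.
Proof. by rewrite /omega expf_neq0 // -unitfE (valP g). Qed.

Lemma omega_exp_neq0 j : w ^+ j != 0.
Proof. by rewrite expf_neq0 // omega_neq0. Qed.

Lemma primitive_exp_neq0 j : val g ^+ j != 0.
Proof. by rewrite expf_neq0 // -unitfE (valP g). Qed.

Lemma omega_sum : 1 + w + w ^+ 2 = 0.
Proof.
have /eqP : (w - 1) * (1 + w + w ^+ 2) = 0.
  by ring: omega_cube.
by rewrite mulf_eq0 subr_eq0 (negPf omega_neq1) => /eqP.
Qed.

(** The square is [1], and [0 < 3t < 6t] rules out [1] itself. *)
Lemma expr_primitive_half : val g ^+ (3 * t) = -1.
Proof.
apply/eqP; have /eqP : (val g ^+ (3 * t)) ^+ 2 = 1.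
  by apply/eqP; rewrite -exprM expr_primitive_eq1 mulnAC dvdnn.
rewrite sqrf_eq1 expr_primitive_eq1 gtnNdvd ?muln_gt0 ?t_gt0 //.
by rewrite ltn_pmul2r ?t_gt0.
Qed.

Lemma opp1_neq1 : -1 != 1 :> F.
Proof.
rewrite -expr_primitive_half expr_primitive_eq1 gtnNdvd ?muln_gt0 ?t_gt0 //.
by rewrite ltn_pmul2r ?t_gt0.
Qed.

(** Odd characteristic, in the form that later makes skew-symmetric forms alternating. *)
Lemma opp_eq_zero (x : F) : x = - x -> x = 0.
Proof.
move=> /eqP; rewrite -subr_eq0 opprK -mulr2n -mulr_natl mulf_eq0.
case/orP => /eqP // two0; case/eqP: opp1_neq1.
by apply/eqP; rewrite eq_sym -subr_eq0 opprK -[1 + 1]/(2%:R) two0.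
Qed.

Lemma omega_exp_mod3 j : w ^+ (j %% 3) = w ^+ j.
Proof.
by rewrite {2}(divn_eq j 3) exprD mulnC exprM omega_cube expr1n mul1r.
Qed.

(** [-1] and [omega] generate the group of sixth roots of unity, and the [g^m] with [m < t]
    represent its cosets in the nonzero scalars. *)
Definition signed_power (s : bool * 'I_3 * 'I_t) : F :=
  (-1) ^+ s.1.1 * w ^+ s.1.2 * val g ^+ s.2.

Lemma signed_power_surj (x : F) : x != 0 -> exists s, x = signed_power s.
Proof.
move=> x0; have Ux : x \is a GRing.unit by rewrite unitfE.
have : FinRing.unit F Ux \in <[g]>%g by rewrite -(eqP gen_g) inE.
case/cyclePmin => k; rewrite order_primitive => ltk /(congr1 val).
rewrite FinRing.val_unitX /= => ->.
(* Divide the exponent by [t]: the remainder is [m], and the quotient selects a sixth root of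
   unity. *)
have ltm : (k %% t < t)%N by rewrite ltn_mod t_gt0.
have ltr : (k %/ t < 6)%N by rewrite ltn_divLR ?t_gt0.
have [e [j ej]] : exists (e : bool) (j : 'I_3),
    val g ^+ (k %/ t * t) = (-1) ^+ e * w ^+ j.
  have h : (val g ^+ t) ^+ 3 = -1 by rewrite -exprM mulnC expr_primitive_half.
  have -> : w = (val g ^+ t) ^+ 2 by rewrite -exprM mulnC.
  rewrite mulnC exprM; move: (_ ^+ t) h => y h.
  (* With [y = g^t] one has [y^3 = -1] and [omega = y^2], so [y = -omega^2]; the other powers
     follow. *)
  move: (k %/ t)%N ltr => [|[|[|[|[|[|//]]]]]] _.
  - by exists false, ord0; rewrite /= !expr0 mulr1.
  - by exists true, (inord 2); rewrite inordK //=; ring: h.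
  - by exists false, (inord 1); rewrite inordK //=; ring: h.
  - by exists true, ord0; rewrite /=; ring: h.
  - by exists false, (inord 2); rewrite inordK //=; ring: h.
  - by exists true, (inord 1); rewrite inordK //=; ring: h.
exists (e, j, Ordinal ltm).
by rewrite /signed_power /= -ej -exprD -divn_eq.
Qed.

(** By counting: [2 * 3 * t] indices map onto the [6t] nonzero scalars. *)
Lemma signed_power_inj : injective signed_power.
Proof.
suff /imset_injP inj : #|signed_power @: setT| == #|[set: bool * 'I_3 * 'I_t]|.
  by move=> x y; apply: inj; rewrite inE.
rewrite eqn_leq leq_imset_card cardsT !card_prod card_bool !card_ord /=.
have -> : (2 * 3 * t)%N = #|[set x : F | x != 0]|.
  have := cardsC1 (0 : F); rewrite card_F addn1 /= => <-.
  by apply: eq_card => x; rewrite !inE.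
apply/subset_leq_card/subsetP => x; rewrite inE => /signed_power_surj[s ->].
exact: imset_f.
Qed.

(** Exponents of [omega] such as [k * 2] arise below, so they are arbitrary naturals here and
    determined modulo 3. The uniqueness arguments for the triples compare scalars in this way. *)
Lemma signed_power_eq (e e' : bool) (j j' : nat) (m m' : 'I_t) :
  (-1) ^+ e * w ^+ j * val g ^+ m = (-1) ^+ e' * w ^+ j' * val g ^+ m' ->
  [/\ e = e', j = j' %[mod 3] & m = m'].
Proof.
have lt3 i : (i %% 3 < 3)%N by rewrite ltn_mod.
rewrite -(omega_exp_mod3 j) -(omega_exp_mod3 j') => eq.
by case: (@signed_power_inj (e, Ordinal (lt3 j), m)
                            (e', Ordinal (lt3 j'), m') eq).
Qed.

End HalfSystem.

(** * Skew-symmetric forms on planes *)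

Section PlaneForms.
Variables (F : finFieldType) (vT : vectType F).
Implicit Types (u v : vT) (L : {vspace vT}).

(** Linear independence, in the asymmetric form that a point off the line of [u] provides
    directly. *)
Definition indep u v : bool := (u != 0) && (v \notin <[u]>%VS).

Lemma indepP u v :
  reflect (forall a b : F, a *: u + b *: v = 0 -> a = 0 /\ b = 0) (indep u v).
Proof.
apply: (iffP andP) => [[u0 vu] a b|uv].
  have [-> | b0] := eqVneq b 0.
    rewrite scale0r addr0 => /eqP; rewrite scaler_eq0 (negPf u0) orbF.
    by move/eqP.
  move/eqP; rewrite addrC addr_eq0 => /eqP bv; case/negP: vu.
  apply/vlineP; exists (b^-1 * - a).
  by rewrite -scalerA scaleNr -bv scalerA mulVf ?scale1r.
split.
  apply/eqP => u0; have := uv 1 0; rewrite u0 scaler0 scale0r addr0.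
  by case=> // /eqP; rewrite oner_eq0.
apply/negP => /vlineP[k vk]; have := uv (- k) 1.
by rewrite vk scale1r scaleNr addNr => -[] // _ /eqP; rewrite oner_eq0.
Qed.

Lemma indepC u v : indep u v = indep v u.
Proof.
by apply/indepP/indepP => uv a b; rewrite addrC => /uv[].
Qed.

Lemma indep_neq0l u v : indep u v -> u != 0.
Proof. by case/andP. Qed.

Lemma indep_coef u v a b a' b' : indep u v ->
  a *: u + b *: v = a' *: u + b' *: v -> a = a' /\ b = b'.
Proof.
move=> /indepP uv eq; have [] := uv (a - a') (b - b').
  by rewrite !scalerBl addrACA -opprD eq subrr.
by move=> /eqP; rewrite subr_eq0 => /eqP -> /eqP; rewrite subr_eq0 => /eqP.
Qed.

Lemma indep_lin u v a b c d : indep u v -> a * d - b * c != 0 ->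
  indep (a *: u + b *: v) (c *: u + d *: v).
Proof.
move=> /indepP uv det; apply/indepP => r s.
rewrite !scalerDr !scalerA addrACA -!scalerDl => /uv[e1 e2].
(* Cramer's rule: eliminating one unknown leaves the other times the determinant. *)
have e3 : r * (a * d - b * c) = 0.
  transitivity (d * (r * a + s * c) - c * (r * b + s * d)); first by ring.
  by rewrite e1 e2 !mulr0 subrr.
have e4 : s * (a * d - b * c) = 0.
  transitivity (a * (r * b + s * d) - b * (r * a + s * c)); first by ring.
  by rewrite e1 e2 !mulr0 subrr.
move/eqP: e3; move/eqP: e4.
by rewrite !mulf_eq0 (negPf det) !orbF => /eqP -> /eqP ->.
Qed.

Lemma indep_scale u v a b : a != 0 -> b != 0 -> indep u v ->
  indep (a *: u) (b *: v).
Proof.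
move=> a0 b0 uv; have := @indep_lin u v a 0 0 b uv.
rewrite !scale0r addr0 add0r; apply.
by rewrite mul0r subr0 mulf_neq0.
Qed.

Lemma dim_plane u v : indep u v -> \dim (<[u]> + <[v]>) = 2%N.
Proof.
move=> uv; case/andP: (uv) => u0 vu.
have v0 : v != 0 by move: uv; rewrite indepC; apply: indep_neq0l.
rewrite dimv_disjoint_sum ?dim_vline ?u0 ?v0 //.
apply/eqP; rewrite -subv0; apply/subvP => x.
rewrite memv_cap => /andP[/vlineP[a ->] /vlineP[b eq]].
case/indepP/(_ a (- b)): uv; first by rewrite scaleNr eq subrr.
by move=> -> _; rewrite scale0r mem0v.
Qed.

Lemma plane_eq L u v : \dim L = 2%N -> u \in L -> v \in L -> indep u v ->
  L = (<[u]> + <[v]>)%VS.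
Proof.
move=> dimL uL vL uv; apply/esym/eqP; rewrite eqEdim dim_plane // dimL leqnn.
by rewrite subv_add -!memvE uL vL.
Qed.

Variable f : forall L, {skew_symmetric (subvs_of L)}.
Hypothesis f_neq0 : forall L, \dim L = 2%N -> exists x y, f L x y != 0.
Hypothesis opp_eq0 : forall x : F, x = - x -> x = 0.

(** Independent [u] and [v] lie in exactly one plane, so the union over planes in [P_vec] becomes a
    condition on [v] alone. *)
Definition plane_form u v : F :=
  let L := (<[u]> + <[v]>)%VS in f L (vsproj L u) (vsproj L v).

Lemma skewC L (x y : subvs_of L) : f L x y = - f L y x.
Proof. by rewrite hermC expr1 mulN1r. Qed.

Lemma skew_self L (x : subvs_of L) : f L x x = 0.
Proof. by apply: opp_eq0; rewrite {1}skewC. Qed.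

(** The form is alternating, so only the two mixed terms of the expansion survive; together they
    give the determinant. *)
Lemma skew_lin L (x y : subvs_of L) a b c d :
  f L (a *: x + b *: y) (c *: x + d *: y) = (a * d - b * c) * f L x y.
Proof.
rewrite linearDr !linearDl !linearZr_LR !linearZl_LR /= !skew_self.
by rewrite (skewC y x); ring.
Qed.

Lemma plane_formE L u v : \dim L = 2%N -> u \in L -> v \in L -> indep u v ->
  f L (vsproj L u) (vsproj L v) = plane_form u v.
Proof.
by move=> dimL uL vL uv; rewrite /plane_form -(plane_eq dimL uL vL uv).
Qed.

(** A multiple of [u] would give the value zero, so the condition in [P_plane] selects only
    independent pairs. *)
Lemma skew_indep L u v : u \in L -> u != 0 ->
  f L (vsproj L u) (vsproj L v) != 0 -> v \in L -> indep u v.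
Proof.
move=> uL u0 fuv vL; rewrite /indep u0; apply: contra fuv => /vlineP[k ->].
by rewrite linearZ linearZr_LR /= skew_self mulr0.
Qed.

(** An invertible change of vectors keeps the plane and hence the form; only the determinant comes
    out. *)
Lemma plane_form_lin u v a b c d : indep u v -> a * d - b * c != 0 ->
  plane_form (a *: u + b *: v) (c *: u + d *: v) =
    (a * d - b * c) * plane_form u v.
Proof.
move=> uv det; set L := (<[u]> + <[v]>)%VS.
have uL : u \in L by apply: subvP (addvSl _ _) _ (memv_line _).
have vL : v \in L by apply: subvP (addvSr _ _) _ (memv_line _).
rewrite -(@plane_formE L) ?dim_plane ?rpredD ?rpredZ //; last exact: indep_lin.
have E r s : vsproj L (r *: u + s *: v) = r *: vsproj L u + s *: vsproj L v.
  by rewrite linearD !linearZ.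
by rewrite !E skew_lin.
Qed.

Lemma plane_form_scale u v a b : a != 0 -> b != 0 -> indep u v ->
  plane_form (a *: u) (b *: v) = a * b * plane_form u v.
Proof.
move=> a0 b0 uv; have := @plane_form_lin u v a 0 0 b uv.
rewrite !scale0r addr0 add0r mul0r subr0; apply.
by rewrite mulf_neq0.
Qed.

Lemma plane_formC u v : indep u v -> plane_form v u = - plane_form u v.
Proof.
move=> uv; have := @plane_form_lin u v 0 1 1 0 uv.
rewrite !scale0r !scale1r addr0 add0r mul0r mulr1 sub0r mulN1r; apply.
by rewrite oppr_eq0 oner_neq0.
Qed.

(** A form vanishing on a basis of the plane would vanish on the whole plane, by the determinant
    formula. *)
Lemma plane_form_neq0 u v : indep u v -> plane_form u v != 0.
Proof.
move=> uv; set L := (<[u]> + <[v]>)%VS.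
have [x [y fxy]] := f_neq0 (dim_plane uv).
apply: contra fxy => /eqP fuv; apply/eqP.
have dec (z : subvs_of L) : exists a b, z = a *: vsproj L u + b *: vsproj L v.
  have /memv_addP[_ /vlineP[a ->] [_ /vlineP[b ->]]] := subvsP z.
  move=> eq; exists a, b.
  by rewrite -[z]vsvalK eq linearD !linearZ.
have [a [b ->]] := dec x; have [c [d ->]] := dec y.
by rewrite skew_lin -/(plane_form u v) fuv mulr0.
Qed.

End PlaneForms.

(** * The triples T(u,v) *)

Section Triangles.
Variables (F : finFieldType) (t n : nat) (g : {unit F}).
Hypothesis card_F : #|F| = (6 * t + 1)%N.
Hypothesis gen_g : generator [set: {unit F}] g.
Local Notation w := (omega t (val g)).
Local Notation W := 'rV[F]_n.
Implicit Types (u v x y : W) (B : {set with_infty W}) (s e : bool).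

Let w3 : w ^+ 3 = 1 := omega_cube card_F gen_g.
Let w2 : w ^+ 2 = -1 - w.
Proof.
by rewrite -[LHS]subr0 -(omega_sum card_F gen_g); ring.
Qed.
Let wj0 := omega_exp_neq0 t g.

Lemma omega_exp_cube j : (w ^+ j) ^+ 3 = 1.
Proof. by rewrite exprAC w3 expr1n. Qed.

Lemma omega_exp_eq j k : (w ^+ j == w ^+ k) = (j == k %[mod 3]).
Proof.
apply/eqP/eqP => [eq | eq]; last first.
  by rewrite -(omega_exp_mod3 card_F gen_g) eq (omega_exp_mod3 card_F gen_g).
pose o := Ordinal (t_gt0 card_F gen_g).
case: (@signed_power_eq _ _ _ card_F gen_g false false j k o o) => //.
by rewrite eq.
Qed.

(** Distinct exponents below 3 exhaust [0, 1, 2], and squaring permutes the cube roots of unity, so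
    both sums are [1 + omega + omega^2]. *)
Lemma omega_exp_sum0 (j k l : 'I_3) : j != k -> l != j -> l != k ->
  w ^+ j + w ^+ k + w ^+ l = 0 /\
  (w ^+ j) ^+ 2 + (w ^+ k) ^+ 2 + (w ^+ l) ^+ 2 = 0.
Proof.
case: j k l => [[|[|[|//]]] ?] [[|[|[|//]]] ?] [[|[|[|//]]] ?] //= _ _ _;
  by split; ring: w2.
Qed.

(* The points of [T(u,v)] are indexed by the power of omega in front of [v], so
   the second and third points of [triple] are [j = 2] and [j = 1]. *)
Definition tri_pt s j u v : W :=
  (-1) ^+ s *: ((w ^+ j) ^+ 2 *: u + w ^+ j *: v).

Definition tri s u v : {set with_infty W} :=
  [set inl (tri_pt s (j : 'I_3) u v) | j : 'I_3].

Lemma mem_triP z s u v :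
  reflect (exists j, z = inl (tri_pt s j u v)) (z \in tri s u v).
Proof.
apply: (iffP imsetP) => [[j _ ->] | [j ->]]; first by exists j.
have lt3 : (j %% 3 < 3)%N by rewrite ltn_mod.
by exists (Ordinal lt3); rewrite // /tri_pt /= (omega_exp_mod3 card_F gen_g).
Qed.

Lemma tri_ptE s j u v :
  tri_pt s j u v =
    ((-1) ^+ s * (w ^+ j) ^+ 2) *: u + ((-1) ^+ s * w ^+ j) *: v.
Proof. by rewrite /tri_pt scalerDr !scalerA. Qed.

Lemma triple_tri u v : triple w u v = tri false u v.
Proof.
apply/setP => z; rewrite !inE; apply/idP/mem_triP.
  case/orP => [/orP[]|] /eqP ->.
  - exists 0%N; congr inl; rewrite tri_ptE; apply/rowP => i; rewrite !mxE.
    by ring.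
  - exists 2%N; congr inl; rewrite tri_ptE; apply/rowP => i; rewrite !mxE.
    by ring: w3.
  - exists 1%N; congr inl; rewrite tri_ptE; apply/rowP => i; rewrite !mxE.
    by ring.
case=> j ->; rewrite /tri_pt -(omega_exp_mod3 card_F gen_g j).
have : (j %% 3 < 3)%N by rewrite ltn_mod.
move: (j %% 3)%N => [|[|[|//]]] _; rewrite expr0 scale1r.
- by rewrite expr0 expr1n !scale1r eqxx.
- by rewrite expr1 eqxx !orbT.
have -> : (w ^+ 2) ^+ 2 = w by ring: w3.
by rewrite eqxx orbT.
Qed.

Lemma opp_triple_tri u v : opp_set (triple w u v) = tri true u v.
Proof.
rewrite triple_tri /opp_set /tri -imset_comp; apply: eq_imset => j /=.
by rewrite /tri_pt expr0 expr1 scale1r scaleN1r.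
Qed.

(** The determinant of the coefficients is [omega^(j+k) (omega^j - omega^k)]. *)
Lemma tri_pt_indep s j k u v : indep u v -> j != k %[mod 3] ->
  indep (tri_pt s j u v) (tri_pt s k u v).
Proof.
move=> uv jk; rewrite !tri_ptE; apply: indep_lin => //.
have -> : (-1) ^+ s * (w ^+ j) ^+ 2 * ((-1) ^+ s * w ^+ k) -
    (-1) ^+ s * w ^+ j * ((-1) ^+ s * (w ^+ k) ^+ 2) =
    ((-1) ^+ s) ^+ 2 * (w ^+ j) * (w ^+ k) * (w ^+ j - w ^+ k) by ring.
rewrite sqrr_sign mul1r; apply: mulf_neq0; first by rewrite mulf_neq0 // wj0.
by rewrite subr_eq0 omega_exp_eq.
Qed.

Lemma tri_pt_inj s u v (j k : 'I_3) : indep u v ->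
  tri_pt s j u v = tri_pt s k u v -> j = k.
Proof.
move=> uv; rewrite !tri_ptE => /(indep_coef uv)[_ /mulfI].
rewrite signr_eq0 => /(_ isT) /eqP; rewrite omega_exp_eq !modn_small //.
by move=> /eqP/val_inj.
Qed.

Lemma card_tri s u v : indep u v -> #|tri s u v| = 3%N.
Proof.
move=> uv; rewrite card_imset ?card_ord // => j k [].
exact: tri_pt_inj.
Qed.

(** The coefficient of [v] in each point is nonzero, which keeps the triple off the line of [u]. *)
Lemma tri_mem_indep s u v z : indep u v -> z \in tri s u v ->
  exists2 x, z = inl x & indep u x.
Proof.
move=> uv /mem_triP[j ->]; exists (tri_pt s j u v) => //.
rewrite tri_ptE -[X in indep X]scale1r -[1 *: u]addr0 -(scale0r v).
apply: indep_lin => //.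
by rewrite mul1r mul0r subr0 mulf_neq0 ?signr_eq0 ?wj0.
Qed.

(** The coefficient of [v] has inverse [(-1)^s omega^(2j)]. So for given [u] and [x], each choice of
    sign and exponent leaves exactly one [v]. *)
Lemma tri_pt_solve s j u v x :
  x = tri_pt s j u v <->
  v = (- w ^+ j) *: u + ((-1) ^+ s * (w ^+ j) ^+ 2) *: x.
Proof.
have ej := omega_exp_cube j.
have es : ((-1) ^+ s) ^+ 2 = 1 :> F by rewrite sqrr_sign.
by split=> ->; rewrite !tri_ptE; apply/rowP => i; rewrite !mxE; ring: ej es.
Qed.

(** By [omega_exp_sum0] the three points sum to zero, so any two determine the third. *)
Lemma tri_zero_sum s u v x y : indep u v -> x != y ->
  inl x \in tri s u v -> inl y \in tri s u v ->
  indep x y /\ tri s u v = [set inl x; inl y; inl (- (x + y))].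
Proof.
move=> uv xy /imsetP[j _ [ex]] /imsetP[k _ [ey]].
have jk : j != k by apply: contra xy => /eqP jk; rewrite ex ey jk.
split.
  by rewrite ex ey; apply: tri_pt_indep; rewrite // !modn_small.
apply/eqP; rewrite eqEcard card_tri //; apply/andP; split; last first.
  by apply: leq_trans (leq_card_setU _ _) _; rewrite cards1 cards2; case: eqP.
apply/subsetP => _ /imsetP[l _ ->]; rewrite !inE.
have [-> | lj] := eqVneq l j; first by rewrite ex eqxx.
have [-> | lk] := eqVneq l k; first by rewrite ey eqxx orbT.
apply/orP; right; apply/eqP; congr inl.
have [s1 s2] := omega_exp_sum0 jk lj lk.
apply/eqP; rewrite -addr_eq0 addrC ex ey !tri_ptE; apply/eqP/rowP => i.
rewrite !mxE.
transitivity ((-1) ^+ s *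
  (((w ^+ j) ^+ 2 + (w ^+ k) ^+ 2 + (w ^+ l) ^+ 2) * u 0 i +
   (w ^+ j + w ^+ k + w ^+ l) * v 0 i)); first by ring.
by rewrite s1 s2 !mul0r addr0 mulr0.
Qed.

Lemma tri_sub_eq s e u v x y : indep u v -> indep x y ->
  (forall j, exists k, tri_pt s j u v = tri_pt e k x y) ->
  tri s u v = tri e x y.
Proof.
move=> uv xy sub; apply/eqP; rewrite eqEcard !card_tri // leqnn andbT.
apply/subsetP => _ /mem_triP[j ->]; have [k ->] := sub j.
by apply/mem_triP; exists k.
Qed.

(** Doubling [j] exchanges the coefficients [omega^(2j)] and [omega^j], because
    [omega^(4j) = omega^j]. *)
Lemma tri_swap s u v : indep u v -> tri s u v = tri s v u.
Proof.
move=> uv; apply: tri_sub_eq => //; first by rewrite indepC.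
move=> j; exists (j * 2)%N; have ej := omega_exp_cube j.
by rewrite !tri_ptE exprM; apply/rowP => i; rewrite !mxE; ring: ej.
Qed.

(** A factor [+-omega^k] passes from one argument to the other, its sign becoming the sign of the
    triple. Matching the coefficients of [v] sends the exponent [j] to [j + 2k]. *)
Lemma tri_rescale e k u v : indep u v ->
  tri false (((-1) ^+ e * w ^+ k) *: u) v =
    tri e u (((-1) ^+ e * w ^+ k) *: v).
Proof.
set c := _ * _; have c0 : c != 0 by rewrite mulf_neq0 ?signr_eq0 ?wj0.
move=> uv; have uv1 : indep (c *: u) v.
  by rewrite -[v]scale1r indep_scale ?oner_neq0.
have uv2 : indep u (c *: v) by rewrite -[u]scale1r indep_scale ?oner_neq0.
apply: tri_sub_eq => // j; exists (j + k * 2)%N.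
have ej := omega_exp_cube j; have ek := omega_exp_cube k.
have es : ((-1) ^+ e) ^+ 2 = 1 :> F by rewrite sqrr_sign.
rewrite !tri_ptE exprD exprM /c; apply/rowP => i; rewrite !mxE.
by ring: ej ek es.
Qed.

Lemma tri_of_pair x y : indep x y -> exists u v,
  [/\ indep u v, inl x \in tri false u v & inl y \in tri false u v].
Proof.
move=> xy; set d := w ^+ 2 - w.
have d0 : d != 0 by rewrite subr_eq0 -[X in _ == X]expr1 omega_exp_eq.
(* The solution of [u + v = x] and [omega^2 u + omega v = y], which makes [x] and [y] the points
   [j = 0] and [j = 1]; up to sign, [d] is the determinant of this system. *)
exists ((- w / d) *: x + d^-1 *: y), ((w ^+ 2 / d) *: x + (- d^-1) *: y).
split.
- apply: indep_lin => //.
  have -> : - w / d * - d^-1 - d^-1 * (w ^+ 2 / d) = - d^-1 * (d / d).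
    by rewrite /d; ring.
  by rewrite mulfV // mulr1 oppr_eq0 invr_eq0.
- apply/mem_triP; exists 0%N; congr inl; rewrite tri_ptE.
  apply/rowP => i; rewrite !mxE !expr0 expr1n !mul1r.
  transitivity ((d / d) * x 0 i); first by rewrite mulfV ?mul1r.
  by rewrite /d; ring.
- apply/mem_triP; exists 1%N; congr inl; rewrite tri_ptE.
  apply/rowP => i; rewrite !mxE !expr0 !expr1 !mul1r.
  transitivity ((d / d) * y 0 i); first by rewrite mulfV ?mul1r.
  by rewrite /d; ring: w3.
Qed.

(** The points 0 and 1 of the first triple are points [j] and [k] of the second. Their difference
    [d = k - j] modulo 3 decides: 0 would force [omega = 1], 1 keeps the order of the generators,
    and 2 swaps them. *)
Lemma tri_eq_cases s e u v x y : indep u v -> indep x y ->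
  tri s u v = tri e x y ->
  exists (e' : bool) (j : nat),
    let X := ((-1) ^+ e' * (w ^+ j) ^+ 2) *: x in
    let Y := ((-1) ^+ e' * w ^+ j) *: y in
    (u = X /\ v = Y) \/ (u = Y /\ v = X).
Proof.
move=> uv xy eq.
have /mem_triP[j [e0]] : inl (tri_pt s 0 u v) \in tri e x y.
  by rewrite -eq; apply/mem_triP; exists 0%N.
have /mem_triP[k [e1]] : inl (tri_pt s 1 u v) \in tri e x y.
  by rewrite -eq; apply/mem_triP; exists 1%N.
exists (s (+) e), j => X Y.
have es : ((-1) ^+ s) ^+ 2 = 1 :> F by rewrite sqrr_sign.
have E0 : u + v = X + Y.
  have : (-1) ^+ s *: tri_pt s 0 u v = (-1) ^+ s *: tri_pt e j x y.
    by rewrite e0.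
  rewrite {1}/tri_pt !expr0 expr1n !scale1r scalerA -expr2 es scale1r => ->.
  by rewrite tri_ptE /X /Y signr_addb; apply/rowP => i; rewrite !mxE; ring.
(* [2 * j] stands for [-j] modulo 3. *)
have [d /andP[lt3 /eqP ek]] :
    exists d, (d < 3)%N && (w ^+ k == w ^+ j * w ^+ d).
  exists ((k + 2 * j) %% 3)%N; rewrite ltn_mod /= (omega_exp_mod3 card_F gen_g).
  have ej := omega_exp_cube j.
  by rewrite exprD mulnC exprM; apply/eqP; ring: ej.
have E1 : w ^+ 2 *: u + w *: v = (w ^+ d) ^+ 2 *: X + w ^+ d *: Y.
  have : (-1) ^+ s *: tri_pt s 1 u v = (-1) ^+ s *: tri_pt e k x y.
    by rewrite e1.
  rewrite {1}/tri_pt !expr1 scalerA -expr2 es scale1r => ->.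
  rewrite tri_ptE /X /Y signr_addb ek; apply/rowP => i; rewrite !mxE; ring.
have w1 := omega_neq1 card_F gen_g.
have d0 : w ^+ 2 - w != 0 by rewrite subr_eq0 -[X in _ == X]expr1 omega_exp_eq.
have Eu : (w ^+ 2 - w) *: u = ((w ^+ d) ^+ 2 - w) *: X + (w ^+ d - w) *: Y.
  transitivity ((w ^+ 2 *: u + w *: v) - w *: (u + v)).
    by apply/rowP => i; rewrite !mxE; ring.
  by rewrite E0 E1; apply/rowP => i; rewrite !mxE; ring.
case: d lt3 {ek} E1 Eu => [|[|[|//]]] _ E1 Eu.
- exfalso; move: E1; rewrite expr0 expr1n !scale1r -E0.
  rewrite -[in RHS](scale1r u) -[in RHS](scale1r v).
  by case/(indep_coef uv) => _ /eqP; apply/negP.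
- left; move: Eu; rewrite expr1 subrr scale0r addr0 => /(scalerI d0) Eu.
  by split => //; apply: (addrI u); rewrite E0 {1}Eu.
- right; have w4 : (w ^+ 2) ^+ 2 = w by ring: w3.
  move: Eu; rewrite w4 subrr scale0r add0r => /(scalerI d0) Eu.
  by split => //; apply: (addrI u); rewrite E0 {1}Eu addrC.
Qed.

End Triangles.

(** * The classes P_{u,c} *)

Section TriangleBlocks.
Variables (F : finFieldType) (t n : nat) (g : {unit F}).
Hypothesis card_F : #|F| = (6 * t + 1)%N.
Hypothesis gen_g : generator [set: {unit F}] g.
Local Notation w := (omega t (val g)).
Local Notation W := 'rV[F]_n.
Variable f : forall L : {vspace W}, {skew_symmetric (subvs_of L)}.
Hypothesis f_neq0 : forall L : {vspace W}, \dim L = 2%N ->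
  exists x y : subvs_of L, f L x y != 0.
Implicit Types (u v x y : W) (B : {set with_infty W}) (s e : bool).

Let opp0 := opp_eq_zero card_F gen_g.
Let wj0 := omega_exp_neq0 t g.
Let wj20 j : (w ^+ j) ^+ 2 != 0.
Proof. by rewrite expf_neq0. Qed.
Let gj0 := primitive_exp_neq0 g.

(** The plane disappears: the nonzero value [g^m c] forces independence, and then the plane is the
    span of [u] and [v]. *)
Lemma P_vecP B u c : u != 0 -> c != 0 ->
  B \in P_vec t (val g) f u c <->
  exists s v (m : 'I_t),
    [/\ indep u v, plane_form f u v = val g ^+ m * c & B = tri t g s u v].
Proof.
move=> u0 c0; split.
  case/bigcupP => L /andP[uL /eqP dimL]; rewrite -memvE in uL.
  have main v : v \in [set v : W | (v \in L) && [exists m : 'I_t,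
        f L (vsproj L u) (vsproj L v) == val g ^+ m * c]] ->
      exists m : 'I_t, indep u v /\ plane_form f u v = val g ^+ m * c.
    rewrite inE => /andP[vL /existsP[m /eqP fm]]; exists m.
    have uv : indep u v.
      apply: (@skew_indep _ _ f opp0 L u v uL u0 _ vL).
      by rewrite fm mulf_neq0.
    by split=> //; rewrite -fm (plane_formE f dimL uL vL uv).
  rewrite inE => /orP[] /imsetP[v /main[m [uv fm]] ->].
    by exists false, v, m; rewrite triple_tri.
  by exists true, v, m; rewrite opp_triple_tri.
case=> s [v [m [uv fm ->]]]; apply/bigcupP.
exists (<[u]> + <[v]>)%VS; first by rewrite addvSl dim_plane.
have vV : v \in [set v0 : W | (v0 \in (<[u]> + <[v]>)%VS) && [exists m : 'I_t,
    f (<[u]> + <[v]>) (vsproj (<[u]> + <[v]>) u)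
      (vsproj (<[u]> + <[v]>) v0) == val g ^+ m * c]].
  rewrite inE (subvP (addvSr _ _) _ (memv_line _)) /=.
  by apply/existsP; exists m; apply/eqP.
rewrite inE; apply/orP; case: s; [right|left]; apply/imsetP; exists v => //.
  by rewrite opp_triple_tri.
by rewrite triple_tri.
Qed.

Lemma P_vec_card B u c : u != 0 -> c != 0 ->
  B \in P_vec t (val g) f u c -> #|B| = 3%N.
Proof.
by move=> u0 c0 /(P_vecP _ u0 c0)[s [v [m [uv _ ->]]]]; apply: card_tri.
Qed.

Lemma P_vec_mem B u c z : u != 0 -> c != 0 ->
  B \in P_vec t (val g) f u c -> z \in B -> exists2 x, z = inl x & indep u x.
Proof.
move=> u0 c0 /(P_vecP _ u0 c0)[s [v [m [uv _ ->]]]].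
exact: tri_mem_indep.
Qed.

Lemma P_vec_cover u c x : c != 0 -> indep u x ->
  exists! B, B \in P_vec t (val g) f u c /\ inl x \in B.
Proof.
move=> c0 ux; have u0 := indep_neq0l ux.
have solve_form s j (v : W) :
    v = (- w ^+ j) *: u + ((-1) ^+ s * (w ^+ j) ^+ 2) *: x ->
    indep u v /\
    plane_form f u v = (-1) ^+ s * (w ^+ j) ^+ 2 * plane_form f u x.
  have det : 1 * ((-1) ^+ s * (w ^+ j) ^+ 2) - 0 * (- w ^+ j) != 0.
    by rewrite mul1r mul0r subr0 mulf_neq0 ?signr_eq0 ?wj20.
  have E : u = 1 *: u + 0 *: x by rewrite scale1r scale0r addr0.
  move=> ->; split; first by rewrite [X in indep X]E indep_lin.
  by have := plane_form_lin f opp0 ux det; rewrite -E mul1r mul0r subr0.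
(* The sign and exponent of [phi(u,x) / c] tell which triple to take: since
   [omega^(2j) omega^j = 1], they cancel and leave [phi(u,v) = g^m c]. *)
have y0 : plane_form f u x / c != 0.
  by rewrite mulf_neq0 ?invr_eq0 ?plane_form_neq0.
have [[[s j] m] eq] := signed_power_surj card_F gen_g y0.
have es e : ((-1) ^+ e) ^+ 2 = 1 :> F by rewrite sqrr_sign.
have fux : plane_form f u x = (-1) ^+ s * w ^+ j * val g ^+ m * c.
  by move: eq; rewrite /signed_power /= => <-; rewrite divfK.
pose v := (- w ^+ j) *: u + ((-1) ^+ s * (w ^+ j) ^+ 2) *: x.
have [uv fuv] := solve_form s j v erefl.
exists (tri t g s u v); split.
  split.
    apply/(P_vecP _ u0 c0); exists s, v, m; split=> //.
    rewrite fuv fux; have ej := omega_exp_cube card_F gen_g j.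
    by ring: (es s) ej.
  apply/(mem_triP card_F gen_g); exists j; congr inl.
  exact/(tri_pt_solve card_F gen_g).
move=> B [/(P_vecP _ u0 c0)[s' [v' [m' [uv' fuv' ->]]]]].
case/(mem_triP card_F gen_g) => j' [/(tri_pt_solve card_F gen_g) ev].
have [_] := solve_form s' j' v' ev; rewrite fuv' fux => fm.
have ej := omega_exp_cube card_F gen_g j'.
(* Any other triple through [x] yields a second decomposition of [phi(u,x) / c]. *)
have : (-1) ^+ s * w ^+ j * val g ^+ m = (-1) ^+ s' * w ^+ j' * val g ^+ m'.
  apply: (mulIf c0).
  transitivity ((-1) ^+ s' * w ^+ j' * (val g ^+ m' * c)); last by ring.
  by rewrite fm; ring: (es s') ej.
case/(signed_power_eq card_F gen_g) => es' ej' _.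
have {}ej' : w ^+ j = w ^+ j' by apply/eqP; rewrite omega_exp_eq // ej'.
by rewrite ev -es' -ej'.
Qed.

Lemma P_vec_pair B u c x y : u != 0 -> c != 0 ->
  B \in P_vec t (val g) f u c -> x != y -> inl x \in B -> inl y \in B ->
  indep x y /\ B = [set inl x; inl y; inl (- (x + y))].
Proof.
move=> u0 c0 /(P_vecP _ u0 c0)[s [v [m [uv _ ->]]]].
exact: tri_zero_sum.
Qed.

Variables (N : nat) (u : 'I_N -> W).
Hypothesis u_neq0 : forall i, u i != 0.
Hypothesis line_cover : forall x, x != 0 -> exists i, x \in <[u i]>%VS.
Hypothesis line_inj : forall i j x,
  x != 0 -> x \in <[u i]>%VS -> x \in <[u j]>%VS -> i = j.

Lemma P_vec_exists x y : indep x y -> exists i (a : 'I_t) (b : 'I_3) B,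
  [/\ B \in P_vec t (val g) f (val g ^+ a *: u i) (w ^+ b),
      inl x \in B & inl y \in B].
Proof.
case/(tri_of_pair card_F gen_g) => u1 [v1 [uv1 x1 y1]].
(* Order the generators so that their form carries no factor [-1]; swapping them keeps the
   triple. *)
have [U [V [UV xU yU [b [m fUV]]]]] : exists U V, [/\ indep U V,
    inl x \in tri t g false U V, inl y \in tri t g false U V &
    exists (b : 'I_3) (m : 'I_t), plane_form f U V = val g ^+ m * w ^+ b].
  have [[[s b] m]] :=
    signed_power_surj card_F gen_g (plane_form_neq0 f_neq0 opp0 uv1).
  rewrite /signed_power /=; case: s => fuv.
    exists v1, u1; rewrite -(tri_swap card_F gen_g) //; split=> //.
      by rewrite indepC.
    by exists b, m; rewrite plane_formC // fuv expr1; ring.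
  by exists u1, v1; split=> //; exists b, m; rewrite fuv expr0; ring.
have U0 := indep_neq0l UV.
have [i /vlineP[d Ud]] := line_cover U0.
have d0 : d != 0 by apply: contraNneq U0 => d0; rewrite Ud d0 scale0r.
(* Write [U = c g^a u_i] with [c = +-omega^k]; the factor [c] then moves to [V], which changes
   neither the triple nor the value of the form. *)
have [[[e k] a] dd] := signed_power_surj card_F gen_g d0.
rewrite /signed_power /= in dd.
set c := (-1) ^+ e * w ^+ k in dd.
have c0 : c != 0 by rewrite mulf_neq0 ?signr_eq0 ?wj0.
have EU : U = c *: (val g ^+ a *: u i) by rewrite Ud dd scalerA.
have ui0 : val g ^+ a *: u i != 0 by rewrite scaler_eq0 negb_or gj0 u_neq0.
have uV : indep (val g ^+ a *: u i) V.
  rewrite -[V]scale1r -[_ *: u i]scale1r -(mulVf c0) -[X in indep X]scalerA -EU.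
  by rewrite indep_scale ?invr_eq0 // mulVf ?oner_neq0.
exists i, a, b, (tri t g e (val g ^+ a *: u i) (c *: V)).
rewrite -(tri_rescale card_F gen_g) // -EU; split=> //.
apply/P_vecP => //; exists e, (c *: V), m; split; last 1 first.
- by rewrite EU (tri_rescale card_F gen_g).
- by rewrite -[_ *: u i]scale1r indep_scale ?oner_neq0.
rewrite -[val g ^+ a *: u i]scale1r -fUV plane_form_scale ?oner_neq0 // mul1r.
by rewrite [in RHS]EU -[V in RHS]scale1r plane_form_scale ?oner_neq0 // mulr1.
Qed.

Lemma P_vec_index_inj B i i' (a a' : 'I_t) (b b' : 'I_3) :
  B \in P_vec t (val g) f (val g ^+ a *: u i) (w ^+ b) ->
  B \in P_vec t (val g) f (val g ^+ a' *: u i') (w ^+ b') ->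
  [/\ i = i', a = a' & b = b'].
Proof.
have nz (k : 'I_t) h : val g ^+ k *: u h != 0.
  by rewrite scaler_eq0 negb_or gj0 u_neq0.
case/(P_vecP _ (nz _ _) (wj0 _)) => s [v [m [uv fuv EB]]].
case/(P_vecP _ (nz _ _) (wj0 _)) => s' [v' [m' [uv' fuv' EB']]].
have [e [k cases]] := tri_eq_cases card_F gen_g uv uv' (etrans (esym EB) EB').
have X0 : (-1) ^+ e * (w ^+ k) ^+ 2 != 0.
  by rewrite mulf_neq0 ?signr_eq0 ?wj20.
have Y0 : (-1) ^+ e * w ^+ k != 0 by rewrite mulf_neq0 ?signr_eq0 ?wj0.
have ek := omega_exp_cube card_F gen_g k.
have es : ((-1) ^+ e) ^+ 2 = 1 :> F by rewrite sqrr_sign.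
have one : (-1) ^+ e * (w ^+ k) ^+ 2 * ((-1) ^+ e * w ^+ k) = 1 by ring: es ek.
(* The two rescaling factors have product 1, so the form keeps its value up to the sign of the swap.
   The swapped case is treated first and dies on that sign. *)
case: cases => [[eu ev]|[ev eu]]; last first.
  have : plane_form f (val g ^+ a *: u i) v =
      - plane_form f (val g ^+ a' *: u i') v'.
    rewrite eu ev plane_formC ?indep_scale // plane_form_scale //.
    by rewrite one mul1r.
  rewrite fuv fuv' => eq.
  have : (-1) ^+ false * w ^+ b * val g ^+ m =
      (-1) ^+ true * w ^+ b' * val g ^+ m'.
    transitivity (val g ^+ m * w ^+ b); first by ring.
    by rewrite eq; ring.
  by case/(signed_power_eq card_F gen_g).
have : plane_form f (val g ^+ a *: u i) v =
    plane_form f (val g ^+ a' *: u i') v'.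
  by rewrite eu ev plane_form_scale // one mul1r.
rewrite fuv fuv' => eq.
have : (-1) ^+ false * w ^+ b * val g ^+ m =
    (-1) ^+ false * w ^+ b' * val g ^+ m'.
  by rewrite mulrAC -mulrA eq; ring.
case/(signed_power_eq card_F gen_g) => _ /eqP.
rewrite !modn_small // => /eqP bb _.
have ii : i = i'.
  apply: (line_inj (nz a i)); first by apply/vlineP; exists (val g ^+ a).
  by apply/vlineP; rewrite eu scalerA; eexists.
split=> //; last exact: val_inj.
move: eu; rewrite ii scalerA => /eqP; rewrite -subr_eq0 -scalerBl scaler_eq0.
rewrite (negPf (u_neq0 i')) orbF subr_eq0 => /eqP eqa.
(* Equal multiples of the same [u_i] have equal coefficients, and these determine [a]. *)
have : (-1) ^+ false * w ^+ 0 * val g ^+ a =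
    (-1) ^+ e * w ^+ (k * 2) * val g ^+ a'.
  by rewrite eqa exprM; ring.
by case/(signed_power_eq card_F gen_g).
Qed.

End TriangleBlocks.

(** * The resolution *)

(** A unique block through each point replaces the partition; blocks of size 3 are nonempty. *)
Lemma is_parallel_classP (X : finType) (P : {set {set X}}) :
  is_parallel_class P <->
  (forall B, B \in P -> #|B| = 3%N) /\
  (forall x, exists! B : {set X}, B \in P /\ x \in B).
Proof.
split=> [[/and3P[/eqP coverP trivP _] card3] | [card3 cover1]].
  split=> // x.
  have /bigcupP[B PB xB] : x \in cover P by rewrite coverP inE.
  exists B; split=> // B' [PB' xB'].
  by rewrite -(def_pblock trivP PB xB) -(def_pblock trivP PB' xB').
split=> //; apply/and3P; split.
- rewrite eqEsubset subsetT /=; apply/subsetP => x _.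
  by have [B [[PB xB] _]] := cover1 x; apply/bigcupP; exists B.
- apply/trivIsetP => A B PA PB; apply: contraR => /pred0Pn[x /andP[xA xB]].
  have [C [_ uC]] := cover1 x; apply/eqP.
  by rewrite -(uC A) ?(uC B).
- by apply/negP => /card3; rewrite cards0.
Qed.

Section Resolution.
Variables (F : finFieldType) (t n : nat) (g : {unit F}).
Hypothesis card_F : #|F| = (6 * t + 1)%N.
Hypothesis gen_g : generator [set: {unit F}] g.
Local Notation w := (omega t (val g)).
Local Notation W := 'rV[F]_n.
Local Notation X := (with_infty W).
Local Notation Y := (with_infty F).
Variable f : forall L : {vspace W}, {skew_symmetric (subvs_of L)}.
Hypothesis f_neq0 : forall L : {vspace W}, \dim L = 2%N ->
  exists x y : subvs_of L, f L x y != 0.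

Variables (N : nat) (i0 : 'I_N) (u : 'I_N -> W) (p : 'I_N -> W -> F).
Hypothesis u_neq0 : forall i, u i != 0.
Hypothesis line_cover : forall x, x != 0 -> exists i, x \in <[u i]>%VS.
Hypothesis line_inj : forall i j x,
  x != 0 -> x \in <[u i]>%VS -> x \in <[u j]>%VS -> i = j.

Variables (D : F -> {set {set Y}}) (Q : F -> nat -> {set {set Y}}).
Hypothesis D_STS : forall c, is_STS (D c).
Hypothesis Q_class : forall c k, (k <= 3 * t)%N -> is_parallel_class (Q c k).
Hypothesis D_Q : forall c A,
  A \in D c <-> exists2 k, (k <= 3 * t)%N & A \in Q c k.
Hypothesis Q_disjoint : forall c k k' A, (k <= 3 * t)%N -> (k' <= 3 * t)%N ->
  A \in Q c k -> A \in Q c k' -> k = k'.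
Hypothesis Q0 : forall c, [set infty1; infty2; inl c] \in Q c 0%N.

Variable z : W.
Implicit Types (i j : 'I_N) (y : X) (B : {set X}).

(** * Blocks on the lines through [z] *)

Definition line_map i (a : Y) : X :=
  infty_map (fun c : F => z - p i z *: u i + c *: u i) a.

Definition on_line i y : bool :=
  if y is inl x then x - z \in <[u i]>%VS else true.

Definition core : {set X} := [set infty1; infty2; inl z].

Local Notation lines i k := (line_blocks Q z (u i) (p i) k).
Local Notation triangles i a b :=
  [set shift_set z S | S in P_vec t (val g) f (val g ^+ a *: u i) (w ^+ b)].

Lemma line_map_inj i : injective (line_map i).
Proof.
move=> [a|a] [b|b] //= [] => [/addrI/eqP|->] //.
rewrite -subr_eq0 -scalerBl scaler_eq0 (negPf (u_neq0 i)) orbF subr_eq0.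
by move/eqP ->.
Qed.

Lemma on_lineP i y : reflect (exists a, y = line_map i a) (on_line i y).
Proof.
apply: (iffP idP) => [|[[a|a] -> //=]]; last first.
  by rewrite addrC -addrA addKr rpredD ?rpredN ?rpredZ ?memv_line.
case: y => [x /= /vlineP[k xk] | j _]; last by exists (inr j).
exists (inl (k + p i z)); congr inl.
by rewrite scalerDl -xk addrACA addNr addr0 addrC subrK.
Qed.

Lemma line_blocksP i k B :
  reflect (exists2 A, A \in Q (p i z) k & B = line_map i @: A)
          (B \in lines i k).
Proof.
have E A : shift_set (z - p i z *: u i) (scale_set A (u i)) = line_map i @: A.
  by rewrite /shift_set /scale_set -imset_comp; apply: eq_imset => -[].
by apply: (iffP imsetP) => -[A QA ->]; exists A; rewrite ?E.
Qed.

(** The translation in [line_map] takes [p i z] to [z], so the distinguished block of [D (p i z)]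
    has the same image for every [i]. *)
Lemma line_map_core i : line_map i @: [set infty1; infty2; inl (p i z)] = core.
Proof. by rewrite !imsetU !imset_set1 /line_map /= subrK. Qed.

Lemma core_line i : core \in lines i 0.
Proof. by apply/line_blocksP; eexists; [exact: Q0 | rewrite line_map_core]. Qed.

Lemma on_line_core i y : y \in core -> on_line i y.
Proof.
by rewrite !inE => /orP[/orP[]|] /eqP -> //=; rewrite subrr mem0v.
Qed.

Lemma on_lines_core i j y : i != j -> on_line i y -> on_line j y -> y \in core.
Proof.
case: y => [x /= ij xi xj | k _ _ _]; rewrite !inE.
  have [->|xz] := eqVneq x z; first by rewrite eqxx orbT.
  by case/eqP: ij; apply: line_inj xi xj; rewrite subr_eq0.
case: k => [[|[|//]] h]; rewrite /infty1 /infty2.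
  by rewrite (_ : Ordinal h = ord0) ?eqxx //; apply: val_inj.
by rewrite (_ : Ordinal h = ord_max) ?eqxx ?orbT //; apply: val_inj.
Qed.

Lemma line_block_card i k B : (k <= 3 * t)%N -> B \in lines i k -> #|B| = 3%N.
Proof.
move=> kt /line_blocksP[A QA ->]; rewrite card_imset; last exact: line_map_inj.
by case: (Q_class (p i z) kt) => _; apply.
Qed.

Lemma line_block_on i k B y : B \in lines i k -> y \in B -> on_line i y.
Proof.
move=> /line_blocksP[A QA ->] /imsetP[a _ ->].
by apply/on_lineP; exists a.
Qed.

Lemma line_blocks_cover i k y : (k <= 3 * t)%N -> on_line i y ->
  exists! B, B \in lines i k /\ y \in B.
Proof.
move=> kt /on_lineP[a ->].
have [_ /(_ a)[A [[QA aA] uA]]] :=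
  (is_parallel_classP _).1 (Q_class (p i z) kt).
exists (line_map i @: A); split.
  by split; [apply/line_blocksP; exists A | apply: imset_f].
move=> B [/line_blocksP[A' QA' ->]].
rewrite mem_imset; last exact: line_map_inj.
by move=> aA'; rewrite (uA A').
Qed.

(** The Steiner property of [D (p i z)], transported along the injection [line_map i]. *)
Lemma line_blocks_pair i y y' : y != y' -> on_line i y -> on_line i y' ->
  exists! B,
    [/\ exists2 k, (k <= 3 * t)%N & B \in lines i k, y \in B & y' \in B].
Proof.
move=> yy' /on_lineP[a ya] /on_lineP[b yb].
have ab : a != b by apply: contra yy' => /eqP ab; rewrite ya yb ab.
have [A [[DA aA bA] uA]] := (D_STS (p i z)).2 a b ab.
exists (line_map i @: A); rewrite ya yb; split.
  split; try exact: imset_f.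
  have [k kt QA] := (D_Q _ _).1 DA; exists k => //.
  by apply/line_blocksP; exists A.
move=> B [[k kt /line_blocksP[A' QA' ->]]].
rewrite !mem_imset; try exact: line_map_inj.
move=> aA' bA'; rewrite (uA A') //; split=> //.
by apply/D_Q; exists k.
Qed.

Lemma line_blocks_disjoint i k k' B : (k <= 3 * t)%N -> (k' <= 3 * t)%N ->
  B \in lines i k -> B \in lines i k' -> k = k'.
Proof.
move=> kt kt' /line_blocksP[A QA ->] /line_blocksP[A' QA'].
move/(imset_inj (@line_map_inj i)) => AA'.
by apply: (Q_disjoint kt kt' QA); rewrite AA'.
Qed.

(** [core] is itself a block on the line [i], and two of its points lie in only one such block. *)
Lemma line_block_core i k B y y' : (k <= 3 * t)%N -> B \in lines i k ->
  y != y' -> y \in core -> y' \in core -> y \in B -> y' \in B -> B = core.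
Proof.
move=> kt Bi yy' yc yc' yB yB'.
have [C [_ uC]] :=
  line_blocks_pair yy' (on_line_core i yc) (on_line_core i yc').
rewrite -(uC B); last by split=> //; exists k.
by apply: uC; split=> //; exists 0%N; rewrite ?core_line.
Qed.

(** * Translates of the triples by [z] *)

Lemma mem_shift x (S : {set X}) :
  (inl x \in shift_set z S) = (inl (x - z) \in S).
Proof.
apply/imsetP/idP => [[[s|j] sS //= [->]]|xS]; first by rewrite addrC addKr.
by exists (inl (x - z)); rewrite //= addrC subrK.
Qed.

Lemma shift_inj : injective (shift_set z).
Proof.
by apply: imset_inj => -[a|a] [b|b] //= [] /addrI ->.
Qed.

Lemma direction_neq0 i a : val g ^+ a *: u i != 0.
Proof.
by rewrite scaler_eq0 negb_or u_neq0 primitive_exp_neq0.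
Qed.

Lemma direction_line i a : <[val g ^+ a *: u i]>%VS = <[u i]>%VS.
Proof.
apply/eqP; rewrite eqEdim !dim_vline direction_neq0 u_neq0 andbT.
by rewrite -memvE rpredZ ?memv_line.
Qed.

Lemma triangle_mem i a b B y : B \in triangles i a b -> y \in B ->
  exists2 x, y = inl x & ~~ on_line i y.
Proof.
move=> /imsetP[S PS ->] /imsetP[s sS ->].
have [x -> /andP[_ ux]] :=
  P_vec_mem card_F gen_g (direction_neq0 _ _) (omega_exp_neq0 t g _) PS sS.
exists (z + x) => //=.
by rewrite addrC addKr -(direction_line i a).
Qed.

Lemma triangle_card i a b B : B \in triangles i a b -> #|B| = 3%N.
Proof.
move=> /imsetP[S PS ->]; rewrite card_imset; last first.
  by move=> [c|c] [d|d] //= [] /addrI ->.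
exact: (P_vec_card card_F gen_g (direction_neq0 _ _) (omega_exp_neq0 t g _) PS).
Qed.

Lemma triangle_cover i a b y : ~~ on_line i y ->
  exists! B, B \in triangles i a b /\ y \in B.
Proof.
case: y => [x /= xi|//].
have ux : indep (val g ^+ a *: u i) (x - z).
  by rewrite /indep direction_neq0 direction_line.
have [S [[PS xS] uS]] :=
  P_vec_cover card_F gen_g f_neq0 (omega_exp_neq0 t g b) ux.
exists (shift_set z S); split; first by rewrite mem_shift imset_f.
move=> B [/imsetP[S' PS' ->]]; rewrite mem_shift => xS'.
by rewrite (uS S').
Qed.

(** The block is expressed by [x], [y] and [z] without [i], [a], [b], so triples of different
    classes through the same two points coincide. *)
Lemma triangle_pair i a b B (x y : W) : B \in triangles i a b -> x != y ->
  inl x \in B -> inl y \in B ->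
  indep (x - z) (y - z) /\
  B = shift_set z
        [set inl (x - z); inl (y - z); inl (- ((x - z) + (y - z)))].
Proof.
move=> /imsetP[S PS ->] xy; rewrite !mem_shift => xS yS.
have xy' : x - z != y - z by apply: contra xy => /eqP/addIr ->.
have [ind ->] := P_vec_pair card_F gen_g (direction_neq0 _ _)
  (omega_exp_neq0 t g _) PS xy' xS yS.
by [].
Qed.

Lemma triangle_not_line i a b j k B B' y y' : (k <= 3 * t)%N ->
  B \in triangles i a b -> B' \in lines j k -> y != y' ->
  y \in B -> y' \in B -> y \in B' -> y' \in B' -> False.
Proof.
move=> kt BT BL yy' yB yB' /(line_block_on BL) ylj /(line_block_on BL) ylj'.
have [x ex _] := triangle_mem BT yB; have [x' ex' _] := triangle_mem BT yB'.
move: yy' yB yB' ylj ylj'; rewrite {}ex {}ex' /= => xx' xB xB'.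
have [ind _] := triangle_pair BT xx' xB xB'.
(* If both points were on line [j], then [x - z = r u_j] and [x' - z = r' u_j], and the coefficients
   [r', -r] would give a linear relation between them. *)
case/vlineP => r er /vlineP[r' er']; case/indepP/(_ r' (- r)): ind => [|r'0 r0].
  by rewrite er er' !scalerA mulNr scaleNr mulrC subrr.
move: xx'; rewrite (_ : x = x') ?eqxx //; apply: (addIr (- z)).
by rewrite er er' r'0 -[r]opprK r0 oppr0.
Qed.

Lemma triangles_disjoint i i' (a a' : 'I_t) (b b' : 'I_3) B :
  B \in triangles i a b -> B \in triangles i' a' b' ->
  [/\ i = i', a = a' & b = b'].
Proof.
move=> /imsetP[S PS ->] /imsetP[S' PS' /shift_inj eS]; rewrite -eS in PS'.
exact: (P_vec_index_inj card_F gen_g u_neq0 line_inj PS PS').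
Qed.

(** * Numbering of the classes of positive index *)

Lemma class_index (a : 'I_t) (b : 'I_3) : (a + b * t + 1 <= 3 * t)%N.
Proof. by case: a b => [a ha] [[|[|[|//]]] hb] /=; lia. Qed.

Lemma class_index_inj (a a' : 'I_t) (b b' : 'I_3) :
  (a + b * t + 1 = a' + b' * t + 1)%N -> a = a' /\ b = b'.
Proof.
case: a a' b b' => [a ha] [a' ha'] [[|[|[|//]]] hb] [[|[|[|//]]] hb'] /= eq;
  by split; apply: val_inj => /=; lia.
Qed.

(** [a] and [b] are the base-[t] digits of [k - 1]; index 0 is left to [P_star]. *)
Lemma class_index_surj k : (0 < k <= 3 * t)%N ->
  exists (a : 'I_t) (b : 'I_3), k = (a + b * t + 1)%N.
Proof.
move=> /andP[k0 kt]; have t0 := t_gt0 card_F gen_g.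
have hb : (k.-1 %/ t < 3)%N by rewrite ltn_divLR //; lia.
have ha : (k.-1 %% t < t)%N by rewrite ltn_mod.
exists (Ordinal ha), (Ordinal hb) => /=.
by rewrite [(k.-1 %% t + _)%N]addnC -divn_eq addn1 prednK.
Qed.

Lemma P_class_parallel i (a : 'I_t) (b : 'I_3) :
  is_parallel_class (P_class t (val g) f Q z (u i) (p i) a b).
Proof.
have kt := class_index a b; apply/is_parallel_classP; split=> [B|y].
  by rewrite inE => /orP[/triangle_card|/(line_block_card kt)].
have [yi|yi] := boolP (on_line i y).
  have [B [[BL yB] uB]] := line_blocks_cover kt yi.
  exists B; split; first by rewrite inE BL orbT.
  move=> B' []; rewrite inE => /orP[BT|BL'] yB'; last exact: uB.
  by have [_ _] := triangle_mem BT yB'; rewrite yi.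
have [B [[BT yB] uB]] := triangle_cover a b yi.
exists B; split; first by rewrite inE BT.
move=> B' []; rewrite inE => /orP[BT'|BL] yB'; first exact: uB.
by move: yi; rewrite (line_block_on BL yB').
Qed.

(** * The star class, the Steiner system and the partition into classes *)

Lemma on_some_line y : exists i, on_line i y.
Proof.
case: y => [x|j]; last by exists i0.
have [->|xz] := eqVneq x z; first by exists i0; rewrite /= subrr mem0v.
by apply: line_cover; rewrite subr_eq0.
Qed.

Lemma P_star_parallel : is_parallel_class (P_star Q u p z).
Proof.
apply/is_parallel_classP; split=> [B /bigcupP[i _]|y].
  exact: line_block_card.
have [i yi] := on_some_line y.
have [B [[BL yB] uB]] := line_blocks_cover (leq0n _) yi.
exists B; split; first by split=> //; apply/bigcupP; exists i.
move=> B' [/bigcupP[j _ BL'] yB'].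
have yj := line_block_on BL' yB'.
have [ij|ij] := eqVneq i j; first by apply: uB; rewrite ij.
(* A point on two lines lies in [core], which is its block in class 0 of both lines. *)
have yc := on_lines_core ij yi yj.
rewrite (uB core); last by rewrite core_line.
have [C [_ uC]] := line_blocks_cover (leq0n _) yj.
by rewrite -(uC B') // (uC core) // core_line.
Qed.

Lemma blocks_atP B :
  B \in blocks_at t (val g) f Q u p z <->
  (exists i, exists2 k, (k <= 3 * t)%N & B \in lines i k) \/
  (exists i (a : 'I_t) (b : 'I_3), B \in triangles i a b).
Proof.
split.
  case/bigcupP => P; rewrite inE => /orP[].
    by rewrite inE => /eqP -> /bigcupP[i _ BL]; left; exists i, 0%N.
  case/imsetP => [[[i a] b] _ ->]; rewrite inE => /orP[BT|BL].
    by right; exists i, a, b.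
  by left; exists i; eexists; [exact: class_index | exact: BL].
case=> [[i [k kt BL]]|[i [a [b BT]]]]; apply/bigcupP.
  have [k0|k0] := posnP k.
    rewrite k0 in BL; exists (P_star Q u p z); first by rewrite !inE eqxx.
    by apply/bigcupP; exists i.
  have [|a [b ek]] := @class_index_surj k; first by rewrite k0.
  exists (P_class t (val g) f Q z (u i) (p i) a b).
    by rewrite inE; apply/orP; right; apply/imsetP; exists (i, a, b).
  by rewrite inE -ek BL orbT.
exists (P_class t (val g) f Q z (u i) (p i) a b).
  by rewrite inE; apply/orP; right; apply/imsetP; exists (i, a, b).
by rewrite inE BT.
Qed.

Lemma collinear_or_indep y y' :
  (exists i, on_line i y && on_line i y') \/
  exists x x', [/\ y = inl x, y' = inl x' & indep (x - z) (x' - z)].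
Proof.
case: y => [x|j]; last first.
  by have [i yi] := on_some_line y'; left; exists i.
have [i xi] := on_some_line (inl x); case: y' => [x'|j]; last first.
  by left; exists i; rewrite xi.
have [xz|xz] := eqVneq (x - z) 0.
  have [j xj] := on_some_line (inl x'); left; exists j.
  by rewrite xj /= xz mem0v.
have [xx'|xx'] := boolP (x' - z \in <[x - z]>%VS); last first.
  by right; exists x, x'; rewrite /indep xz.
left; exists i; rewrite xi /=; apply: subvP xx'.
by rewrite -memvE.
Qed.

Lemma blocks_at_STS : is_STS (blocks_at t (val g) f Q u p z).
Proof.
split=> [B /blocks_atP[[i [k kt BL]]|[i [a [b BT]]]]|y y' yy'].
- exact: (line_block_card kt BL).
- exact: (triangle_card BT).
case: (collinear_or_indep y y') => [[i /andP[yi yi']]|[x [x' [ex ex' ind]]]].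
  have [B [[[k kt BL] yB yB'] uB]] := line_blocks_pair yy' yi yi'.
  exists B; split.
    by split=> //; apply/blocks_atP; left; exists i, k.
  move=> C [/blocks_atP[[j [l lt CL]]|[j [a [b CT]]]] yC yC']; last first.
    by case: (triangle_not_line kt CT BL yy').
  have [ij|ij] := eqVneq i j.
    by apply: uB; split=> //; exists l => //; rewrite ij.
  (* On two different lines both points belong to [core], and then both blocks equal [core]. *)
  have yc := on_lines_core ij yi (line_block_on CL yC).
  have yc' := on_lines_core ij yi' (line_block_on CL yC').
  rewrite (line_block_core lt CL yy' yc yc' yC yC').
  exact: (line_block_core kt BL yy' yc yc' yB yB').
have [i [a [b [S [PS xS xS']]]]] :=
  P_vec_exists card_F gen_g f_neq0 u_neq0 line_cover ind.
have xx' : x != x' by move: yy'; rewrite ex ex'.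
have ST : shift_set z S \in triangles i a b by apply: imset_f.
rewrite -mem_shift in xS; rewrite -mem_shift in xS'.
exists (shift_set z S); rewrite ex ex'; split.
  by split=> //; apply/blocks_atP; right; exists i, a, b.
move=> C [/blocks_atP[[j [l lt CL]]|[j [a' [b' CT]]]] yC yC'].
  by case: (triangle_not_line lt ST CL _ xS xS' yC yC').
have [_ ->] := triangle_pair CT xx' yC yC'.
by have [_ ->] := triangle_pair ST xx' xS xS'.
Qed.

(** A block on two different lines has all its points in [core], hence is [core], which has index 0
    on every line. *)
Lemma line_block_class i j k l B : (k <= 3 * t)%N -> (l <= 3 * t)%N ->
  B \in lines i k -> B \in lines j l -> k = l /\ (i = j \/ k = 0%N).
Proof.
move=> kt lt Bi Bj; have [ij|ij] := eqVneq i j.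
  by split; [apply: (line_blocks_disjoint kt lt Bi); rewrite ij | left].
have Bcore : B \subset core.
  apply/subsetP => y yB.
  exact: (on_lines_core ij (line_block_on Bi yB) (line_block_on Bj yB)).
have eB : B = core.
  apply/eqP; rewrite eqEcard Bcore (line_block_card kt Bi).
  by rewrite (line_block_card (leq0n _) (core_line i)).
rewrite eB in Bi Bj.
have k0 := line_blocks_disjoint kt (leq0n _) Bi (core_line i).
have l0 := line_blocks_disjoint lt (leq0n _) Bj (core_line j).
by rewrite k0 l0; split => //; right.
Qed.

Lemma block_two_points B : #|B| = 3%N ->
  exists y y', [/\ y != y', y \in B & y' \in B].
Proof.
move=> B3; have : (1 < #|B|)%N by rewrite B3.
by case/card_gt1P => y [y' [yB yB' yy']]; exists y, y'.
Qed.

Lemma triangle_line_disjoint i a b j k B : (k <= 3 * t)%N ->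
  B \in triangles i a b -> B \in lines j k -> False.
Proof.
move=> kt BT BL.
have [y [y' [yy' yB yB']]] := block_two_points (triangle_card BT).
exact: (triangle_not_line kt BT BL yy').
Qed.

Lemma classes_at_partition :
  partition (classes_at t (val g) f Q u p z) (blocks_at t (val g) f Q u p z).
Proof.
(* [blocks_at] is the cover of the classes by definition; nonemptiness comes next, then
   disjointness. *)
apply/and3P; split; first exact: eqxx; last first.
  have nonempty (P : {set {set X}}) : is_parallel_class P -> P != set0.
    move=> [/cover_partition cP _]; apply/eqP => P0.
    have : (infty1 : X) \in cover P by rewrite cP inE.
    by rewrite P0 /cover big_set0 inE.
  rewrite in_setU1 negb_or eq_sym nonempty; last exact: P_star_parallel.
  apply/imsetP => -[[[i a] b] _ /esym/eqP] /=.
  by apply/negP/nonempty/P_class_parallel.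
have star_class i (a : 'I_t) (b : 'I_3) B : B \in P_star Q u p z ->
    B \notin P_class t (val g) f Q z (u i) (p i) a b.
  move=> /bigcupP[j _ BL]; have kt := class_index a b; apply/negP.
  rewrite inE => /orP[BT|BL'].
    exact: (triangle_line_disjoint (leq0n _) BT BL).
  by have [] := line_block_class (leq0n _) kt BL BL'; rewrite addn1.
apply/trivIsetP => P P'; rewrite !in_setU1 => /orP[/eqP->|H] /orP[/eqP->|H'].
- by rewrite eqxx.
- case/imsetP: H' => -[[i a] b] _ -> /= _.
  by apply/pred0P => B /=; apply/negP => /andP[/(star_class i a b)/negP].
- case/imsetP: H => -[[i a] b] _ -> /= _.
  by apply/pred0P => B /=; apply/negP => /andP[BP /(star_class i a b)/negP].
case/imsetP: H => -[[i a] b] _ -> /=; case/imsetP: H' => -[[i' a'] b'] _ -> /=.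
apply: contraR => /pred0Pn[B /andP[]] /=.
have kt := class_index a b; have kt' := class_index a' b'.
rewrite inE => /orP[BT|BL]; rewrite inE => /orP[BT'|BL'].
- by have [-> -> ->] := triangles_disjoint BT BT'.
- by case: (triangle_line_disjoint kt' BT BL').
- by case: (triangle_line_disjoint kt BT' BL).
(* Sharing [core] would require index 0, but the indices here are at least 1. *)
have [/class_index_inj[-> ->] [->|]] // := line_block_class kt kt' BL BL'.
by rewrite addn1.
Qed.

End Resolution.

(** * From the given LKTS and lines to the assumptions of the construction *)

Theorem theorem3 (q t n : nat) (F : finFieldType)
  (hF : #|F| = q) (hq : q = (6 * t + 1)%N) (hn : (2 <= n)%N)
  (* the LKTS(q+2) on F with two points at infinity, and its resolutions *)
  (D : F -> {set {set with_infty F}})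
  (hD : is_LKTS (q + 2) [set D i | i : F])
  (hDi : forall i : F, [set infty1; infty2; inl i] \in D i)
  (Q : F -> nat -> {set {set with_infty F}})
  (hQ : forall i : F, is_KTS (q + 2) (D i)
          [set Q i (k : nat) | k : 'I_((q - 1) %/ 2).+1])
  (hQinj : forall i : F, injective (fun k : 'I_((q - 1) %/ 2).+1 => Q i k))
  (hQ0 : forall i : F, [set infty1; infty2; inl i] \in Q i 0%N)
  (* the skew-symmetric bilinear forms on the planes *)
  (f : forall L : {vspace 'rV[F]_n}, {skew_symmetric (subvs_of L)})
  (hf : forall L : {vspace 'rV[F]_n}, \dim L = 2%N ->
          exists x y : subvs_of L, f L x y != 0)
  (g : {unit F}) (hg : generator [set: {unit F}] g)
  (* the lines through the origin *)
  (N : nat) (hN : N = ((q ^ n - 1) %/ (q - 1))%N)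
  (K : 'I_N -> {vspace 'rV[F]_n})
  (hKinj : injective K)
  (hK : [set K i | i : 'I_N] = [set V : {vspace 'rV[F]_n} | \dim V == 1%N])
  (u : 'I_N -> 'rV[F]_n)
  (hu : forall i : 'I_N, u i \in K i /\ u i != 0)
  (R : 'I_N -> {set 'rV[F]_n})
  (hR : forall i : 'I_N, coset_representatives (K i) (R i))
  (p : 'I_N -> 'rV[F]_n -> F)
  (hp : forall (i : 'I_N) (x : 'rV[F]_n), x - p i x *: u i \in R i) :
  forall w : 'rV[F]_n,
    [/\ (forall (i : 'I_N) (a : 'I_t) (b : 'I_3),
           is_parallel_class (P_class t (val g) f Q w (u i) (p i) a b)),
        is_parallel_class (P_star Q u p w),
        is_STS (blocks_at t (val g) f Q u p w) &
        is_KTS (q ^ n + 2) (blocks_at t (val g) f Q u p w)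
          (classes_at t (val g) f Q u p w)].
Proof.
move: hF; rewrite {q}hq in hD hQ hQinj hN * => card_F.
have e3t : ((6 * t + 1 - 1) %/ 2 = 3 * t)%N by lia.
rewrite {}e3t in hQ hQinj.
have dimK i : \dim (K i) = 1%N.
  have : K i \in [set K j | j : 'I_N] by apply: imset_f.
  by rewrite hK inE => /eqP.
have line_eq i x : x != 0 -> x \in K i -> <[x]>%VS = K i.
  by move=> x0 xK; apply/eqP; rewrite eqEdim dim_vline x0 dimK -memvE xK.
have Ku i : <[u i]>%VS = K i by have [uK u0] := hu i; apply: line_eq.
have u_neq0 i : u i != 0 by case: (hu i).
have line_cover x : x != 0 -> exists i, x \in <[u i]>%VS.
  move=> x0; have : <[x]>%VS \in [set V : {vspace 'rV[F]_n} | \dim V == 1%N].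
    by rewrite inE dim_vline x0.
  by rewrite -hK => /imsetP[i _ xK]; exists i; rewrite Ku -xK memv_line.
have line_inj i j x : x != 0 -> x \in <[u i]>%VS -> x \in <[u j]>%VS -> i = j.
  move=> x0; rewrite !Ku => xi xj; apply: hKinj.
  by rewrite -(line_eq i x) // -(line_eq j x).
(* Some line exists because [n >= 2] makes the all-ones vector nonzero; it serves for points at
   infinity and for [z], which lie on every line. *)
have [i0 _] : exists i, const_mx 1 \in <[u i]>%VS.
  apply: line_cover; apply/eqP => /rowP/(_ (Ordinal (ltnW hn))).
  by rewrite !mxE => /eqP; rewrite oner_eq0.
have Q_res c k : (k <= 3 * t)%N ->
    Q c k \in [set Q c (l : nat) | l : 'I_(3 * t).+1].
  by move=> kt; apply/imsetP; exists (Ordinal (kt : (k < (3 * t).+1)%N)).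
have D_STS c : is_STS (D c) by case: (hQ c).
have Q_class c k : (k <= 3 * t)%N -> is_parallel_class (Q c k).
  by move=> kt; case: (hQ c) => _ _ + _; apply; apply: Q_res.
have D_Q c A : A \in D c <-> exists2 k, (k <= 3 * t)%N & A \in Q c k.
  case: (hQ c) => _ _ _ /cover_partition <-; split.
    by case/bigcupP => _ /imsetP[k _ ->] AQ; exists k; rewrite // -ltnS.
  by case=> k kt AQ; apply/bigcupP; exists (Q c k) => //; apply: Q_res.
have Q_disjoint c k k' A : (k <= 3 * t)%N -> (k' <= 3 * t)%N ->
    A \in Q c k -> A \in Q c k' -> k = k'.
  move=> kt kt' Ak Ak'; case: (hQ c) => _ _ _ /partition_trivIset triv.
  (* Two classes sharing a block coincide by the partition; [hQinj] then identifies their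
     indices. *)
  have eQ : Q c k = Q c k'.
    rewrite -(def_pblock triv (Q_res c k kt) Ak).
    exact: def_pblock (Q_res c k' kt') Ak'.
  by case: (hQinj c (Ordinal (kt : (k < (3 * t).+1)%N))
    (Ordinal (kt' : (k' < (3 * t).+1)%N)) eQ).
move=> z; have PC := P_class_parallel card_F hg hf p u_neq0 Q_class z.
have PS := P_star_parallel i0 p u_neq0 line_cover line_inj Q_class hQ0 z.
have STS := blocks_at_STS card_F hg hf i0 p u_neq0 line_cover line_inj
  D_STS Q_class D_Q hQ0 z.
split=> //; split=> //.
- by rewrite card_sum card_mx card_ord mul1n card_F.
- move=> P; rewrite !inE => /orP[/eqP -> // | /imsetP[[[i a] b] _ ->]].
  exact: PC.
- exact: (classes_at_partition card_F hg hf i0 p u_neq0 line_cover line_inj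
    Q_class Q_disjoint hQ0).
Qed.
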